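(* Let $\{p_n\}_{n=0}^\infty$ be a system of eigenpolynomials of a differential operator $$\mathfrak{d}=\sum_{k=1}^{N}a_k(x)\frac{d^k}{dx^k}$$ of order $N$, and assume that for every $n$ all the zeros of $p_n$ are real. Then there exists a compact set containing all the zeros of every $p_n$ if and only if $\deg a_N=N$.
   Context: A differential operator $\mathfrak{d}=\sum_{k=1}^{N}a_k(x)\frac{d^k}{dx^k}$ of order $N\ge 1$ has complex polynomial coefficients $a_k(x)$, with $a_N$ not identically zero. An eigenpolynomial of $\mathfrak{d}$ is a polynomial $p$ with complex coefficients satisfying $\mathfrak{d}p=\lambda p$ for some constant $\lambda$. A complex polynomial system is a sequence $\{p_n\}_{n=0}^\infty$ of polynomials with complex coefficients in one variable $x$ such that $\deg p_n=n$ for every $n\ge 0$. It is a system of eigenpolynomials of $\mathfrak{d}$ if for every $n\ge 0$ there is a constant $\lambda_n\in\mathbb{C}$ with $\mathfrak{d}p_n=\lambda_n p_n$. *)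

(* Defs.v *)
From HB Require Import structures.
From mathcomp Require Import all_boot all_order all_algebra.
From mathcomp Require Import all_classical all_reals all_analysis.
From mathcomp Require Import complex.

Set Implicit Arguments.
Unset Strict Implicit.
Unset Printing Implicit Defensive.

Import Order.TTheory GRing.Theory Num.Theory.
Local Open Scope ring_scope.

(* The coefficients are indexed by all of nat; only a 1, ..., a N matter. *)
Definition diffop (F : fieldType) (N : nat) (a : nat -> {poly F})
    (q : {poly F}) : {poly F} :=
  \sum_(1 <= k < N.+1) a k * q^`(k).

Definition has_order (F : fieldType) (N : nat) (a : nat -> {poly F}) : Prop :=
  (0 < N)%N /\ a N != 0.

Definition eigenpolynomial (F : fieldType) (d : {poly F} -> {poly F})
    (q : {poly F}) : Prop :=
  exists lambda : F, d q = lambda *: q.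

(* size q is 1 + deg q, with size 0 = 0 *)
Definition polynomial_system (F : fieldType) (p : nat -> {poly F}) : Prop :=
  forall n, size (p n) = n.+1.

Definition eigenpolynomial_system (F : fieldType) (d : {poly F} -> {poly F})
    (p : nat -> {poly F}) : Prop :=
  polynomial_system p /\ forall n, eigenpolynomial d (p n).

(* Main.v *)
(* Put D_k = z^k p^(k)(z) with deg p = n. As z p'(z) / p(z) is the sum of
   z / (z - y) over the roots y of p, and Re (z / (z - y)) >= 1/2 for |y| <= |z|,
   any disc |y| <= |z| containing the roots of p contains those of its
   derivatives (up to order n - 1), and |D_(k+1)| >= (n - k)/2 |D_k|. Hence for
   large n the term of order N dominates the eigenvalue equation
   \sum_k a_k(z) z^(-k) D_k = lambda p(z).

   If deg a_N < N then lambda_n = O(n^(N-1)), and if moreover all roots lie in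
   |y| <= M, then at a fixed z with |z| >= 2 M and a_N(z) != 0 the terms of order
   k < N are O(n^(N-1)) |p(z)| while the one of order N is at least of order
   n^N |p(z)|: a contradiction.

   If deg a_N = N then a_k(z) z^(-k) is bounded, and bounded below for k = N,
   outside a disc independent of n. For n large this gives |D_1| <= T |p(z)|
   with T depending only on n, for all z outside this disc that dominate all
   roots of p. At z = (1 + eps) y, with y a root of maximal modulus, this fails
   when eps is small because |D_1 / p(z)| >= Re (z / (z - y)) > 1 / eps. Hence y
   lies in the disc. *)

Require Import Defs.
From mathcomp Require Import all_boot all_order all_algebra.
From mathcomp Require Import all_classical all_reals all_analysis.
From mathcomp Require Import complex.
From mathcomp Require Import ring zify.
Import Order.TTheory GRing.Theory Num.Theory numFieldNormedType.Exports.
Local Open Scope classical_set_scope.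
Local Open Scope ring_scope.

Lemma ffact_le_exp n k : (n ^_ k <= n ^ k)%N.
Proof. by elim: k => // k IH; rewrite ffactnSr expnSr leq_mul// leq_subr. Qed.

(** * Logarithmic derivatives of polynomials *)

Section EigenpolynomialRoots.
Variable C : numClosedFieldType.
Implicit Types (q : {poly C}) (s : seq C) (y z : C).

Definition roots_in_disc q (r : C) := forall y, root q y -> `|y| <= r.

Lemma Re_root_term_ge_half y z : `|y| <= `|z| -> y != z ->
  2^-1 <= 'Re (z / (z - y)).
Proof.
move=> yz; rewrite eq_sym -subr_eq0 => zy0.
(* The claim is |w - 1| <= |w| for w = z / (z - y), squared. *)
set w := z / (z - y).
have w1 : w - 1 = y / (z - y) by rewrite /w; field.
have : `|w - 1| ^+ 2 <= `|w| ^+ 2.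
  rewrite w1 /w ler_pXn2r ?nnegrE ?normr_ge0// !normrM ler_pM2r//.
  by rewrite normr_gt0 invr_eq0.
rewrite !normC2_Re_Im !raddfB /= (Creal_ReP 1 _) ?(Creal_ImP 1 _) ?rpred1//.
rewrite subr0 lerD2r => h; rewrite -subr_ge0; move: h; rewrite -subr_ge0.
have -> : 'Re w ^+ 2 - ('Re w - 1) ^+ 2 = 2 * ('Re w - 2^-1) by field.
by rewrite pmulr_rge0 ?ltr0n.
Qed.

Lemma prod_XsubC_log_deriv s z : z \notin s ->
  (\prod_(y <- s) ('X - y%:P))^`().[z] =
  (\prod_(y <- s) ('X - y%:P)).[z] * \sum_(y <- s) (z - y)^-1.
Proof.
elim: s => [|x s IH]; first by rewrite !big_nil derivC hornerC mulr0.
rewrite inE negb_or => /andP[zx zs].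
rewrite !big_cons derivM derivXsubC !hornerE IH//.
have: z - x != 0 by rewrite subr_eq0.
by move=> ?; field.
Qed.

Lemma log_deriv_roots q : q != 0 -> exists s, [/\ size s = (size q).-1,
  (forall y, root q y = (y \in s)) &
  forall z, ~~ root q z -> z * q^`().[z] = q.[z] * \sum_(y <- s) z / (z - y)].
Proof.
move=> q0; have [s qE] := closed_field_poly_normal q.
have lq0 : lead_coef q != 0 by rewrite lead_coef_eq0.
have rootE y : root q y = (y \in s) by rewrite qE rootZ// root_prod_XsubC.
exists s; split=> //.
  by rewrite qE size_scale// size_prod_XsubC.
move=> z; rewrite rootE => zs.
rewrite -mulr_sumr qE derivZ !hornerZ prod_XsubC_log_deriv//.
by ring.
Qed.

Lemma log_deriv_ge q z : roots_in_disc q `|z| -> ~~ root q z ->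
  (size q).-1%:R / 2 <= 'Re (z * q^`().[z] / q.[z]).
Proof.
move=> qz qz0.
have q0 : q != 0 by apply: contraNneq qz0 => ->; rewrite root0.
have [s [<- rootE ->//]] := log_deriv_roots _ q0.
rewrite mulrAC divff// mul1r raddf_sum/= mulr_natl.
rewrite -iter_addr_0 -count_predT -big_const_seq big_seq_cond [leRHS]big_seq_cond.
apply: ler_sum => y; rewrite andbT -rootE => qy.
by apply: Re_root_term_ge_half; [exact: qz | apply: contraNneq qz0 => <-].
Qed.

(** All terms of the sum have positive real part, so one of them bounds it below; the bound blows up
    as [z] approaches [y] radially. *)
Lemma log_deriv_ge_root q y z : roots_in_disc q `|z| -> ~~ root q z ->
  root q y -> 'Re (z / (z - y)) <= 'Re (z * q^`().[z] / q.[z]).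
Proof.
move=> qz qz0 qy.
have q0 : q != 0 by apply: contraNneq qz0 => ->; rewrite root0.
have [s [_ rootE ->//]] := log_deriv_roots _ q0.
rewrite mulrAC divff// mul1r raddf_sum/=.
rewrite rootE in qy.
rewrite (perm_big _ (perm_to_rem qy))/= big_cons lerDl big_seq.
apply: sumr_ge0 => x /mem_rem; rewrite -rootE => qx.
apply: le_trans (Re_root_term_ge_half _ _ (qz _ qx) _).
  by rewrite invr_ge0 ler0n.
by apply: contraNneq qz0 => <-.
Qed.

Lemma norm_deriv_ge q z : roots_in_disc q `|z| ->
  (size q).-1%:R / 2 * `|q.[z]| <= `|z * q^`().[z]|.
Proof.
move=> qz; have [/rootP->|qz0] := boolP (root q z).
  by rewrite normr0 mulr0.
rewrite -ler_pdivlMr ?normr_gt0// -normf_div.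
apply: le_trans (log_deriv_ge _ _ qz qz0) _.
by rewrite leif_Re_Creal.
Qed.

(** Here [|z - y| >= |z| / 2] for every root [y], so each term [z / (z - y)] has modulus at most
    2. *)
Lemma norm_deriv_le q z : roots_in_disc q (`|z| / 2) ->
  `|z * q^`().[z]| <= 2 * (size q).-1%:R * `|q.[z]|.
Proof.
move=> qz; have [->|z0] := eqVneq z 0.
  by rewrite mul0r normr0 !mulr_ge0.
have qz0 : ~~ root q z.
  apply/negP => /qz; rewrite ler_pdivlMr// ger_pMr ?normr_gt0//.
  by rewrite lern1.
have q0 : q != 0 by apply: contraNneq qz0 => ->; rewrite root0.
have [s [<- rootE ->//]] := log_deriv_roots _ q0.
rewrite normrM mulrC ler_wpM2r//.
apply: le_trans (ler_norm_sum _ _ _) _.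
rewrite mulr_natr -iter_addr_0 -count_predT -big_const_seq.
rewrite big_seq_cond [leRHS]big_seq_cond.
apply: ler_sum => y; rewrite andbT -rootE => qy.
have zy0 : z - y != 0 by rewrite subr_eq0; apply: contraNneq qz0 => ->.
rewrite normf_div ler_pdivrMr ?normr_gt0//.
have zy : `|z| <= `|z - y| + `|z| / 2.
  apply: (@le_trans _ _ (`|z - y| + `|y|)); last by rewrite lerD2l qz.
  by rewrite -{1}(subrK y z) ler_normD.
rewrite -lerBlDr in zy.
rewrite -[leLHS](_ : 2 * (`|z| - `|z| / 2) = _); last by field.
by rewrite ler_pM2l.
Qed.

(** * Degrees, roots and growth of iterated derivatives *)

Lemma size_deriv_num q : size q^`() = (size q).-1.
Proof.
have [->|q0] := eqVneq q 0; first by rewrite deriv0 size_poly0.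
apply/eqP; rewrite eqn_leq; apply/andP; split.
  by rewrite -ltnS (ltn_predK (m := 0)) ?size_poly_gt0// lt_size_deriv.
case E : (size q) => [//|[//|n]] /=.
rewrite ltnNge; apply/negP => /leq_sizeP/(_ n (leqnn n)).
rewrite coef_deriv => /eqP; rewrite mulrn_eq0/= => /eqP qn.
by move/eqP: q0; apply; apply/eqP; rewrite -lead_coef_eq0 lead_coefE E /= qn.
Qed.

Lemma size_derivn_num q k : size q^`(k) = (size q - k)%N.
Proof.
elim: k => [|k IH]; first by rewrite derivn0 subn0.
by rewrite derivnS size_deriv_num IH subnS.
Qed.

(** Gauss-Lucas for discs centred at 0: outside the disc [q] does not vanish, so [norm_deriv_ge]
    keeps the derivative away from 0. *)
Lemma roots_in_disc_deriv q (r : C) : r \is Num.real -> (1 < size q)%N ->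
  roots_in_disc q r -> roots_in_disc q^`() r.
Proof.
move=> rR q1 qr y /rootP qy; rewrite real_leNgt ?normr_real//; apply/negP => ry.
have qy0 : ~~ root q y.
  by apply/negP => /qr; rewrite real_leNgt ?normr_real ?ry.
have qy_disc : roots_in_disc q `|y| by move=> x /qr /le_trans; apply; exact: ltW.
have := norm_deriv_ge q y qy_disc; rewrite qy mulr0 normr0; apply/negP.
rewrite lt_geF// !mulr_gt0 ?invr_gt0 ?normr_gt0 ?ltr0n//.
by rewrite -subn1 subn_gt0.
Qed.

Lemma roots_in_disc_derivn q (r : C) k : r \is Num.real -> (k < size q)%N ->
  roots_in_disc q r -> roots_in_disc q^`(k) r.
Proof.
move=> rR; elim: k => [|k IH]; first by rewrite derivn0.
move=> kq /(IH (ltnW kq)) qr; rewrite derivnS.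
by apply: roots_in_disc_deriv; rewrite // size_derivn_num ltn_subRL addn1.
Qed.

Definition scaled_deriv q z k := z ^+ k * q^`(k).[z].

Lemma scaled_deriv_step_ge q z k : roots_in_disc q `|z| ->
  (size q - k).-1%:R / 2 * `|scaled_deriv q z k| <= `|scaled_deriv q z k.+1|.
Proof.
move=> qz; rewrite /scaled_deriv exprSr -[_ * z * _]mulrA !(normrM (z ^+ k)) mulrCA.
rewrite ler_wpM2l// derivnS -size_derivn_num.
have [kq|qk] := ltnP k (size q).
  by apply: norm_deriv_ge; apply: roots_in_disc_derivn; rewrite ?normr_real.
by rewrite derivn_poly0// size_poly0 horner0 normr0 mulr0.
Qed.

Lemma scaled_deriv_step_le q z k : roots_in_disc q (`|z| / 2) ->
  `|scaled_deriv q z k.+1| <= 2 * (size q).-1%:R * `|scaled_deriv q z k|.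
Proof.
move=> qz; rewrite /scaled_deriv exprSr -[_ * z * _]mulrA !(normrM (z ^+ k)) mulrCA.
rewrite ler_wpM2l// derivnS.
have [kq|qk] := ltnP k (size q); last first.
  by rewrite derivn_poly0// deriv0 horner0 !(mulr0, normr0).
apply: le_trans (norm_deriv_le _ _ _) _.
  exact: roots_in_disc_derivn.
rewrite ler_wpM2r// ler_wpM2l// ler_nat size_derivn_num.
by rewrite -!subn1 leq_sub2r// leq_subr.
Qed.

(** With [n] the degree, a step from order [i] gains a factor [(n - i) / 2], which is at least
    [n / 4] as long as [2 * i <= n]. *)
Lemma scaled_deriv_ge q z k j : roots_in_disc q `|z| ->
  (2 * (k + j) <= (size q).-1)%N ->
  ((size q).-1%:R / 4) ^+ j * `|scaled_deriv q z k| <=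
  `|scaled_deriv q z (k + j)|.
Proof.
move=> qz; elim: j => [|j IH] kj; first by rewrite addn0 expr0 mul1r.
rewrite addnS exprS -mulrA.
apply: le_trans (scaled_deriv_step_ge _ _ _ qz).
have kj' : (2 * (k + j) <= (size q).-1)%N.
  by apply: leq_trans kj; rewrite leq_mul2l addnS leqnSn.
apply: (@le_trans _ _ ((size q).-1%:R / 4 * `|scaled_deriv q z (k + j)|)).
  by rewrite ler_wpM2l ?IH// divr_ge0.
rewrite ler_wpM2r// ler_pdivlMr// mulrAC ler_pdivrMr// -!natrM ler_nat.
lia.
Qed.

Lemma scaled_deriv_le q z k : roots_in_disc q (`|z| / 2) ->
  `|scaled_deriv q z k| <= (2 * (size q).-1%:R) ^+ k * `|q.[z]|.
Proof.
move=> qz; elim: k => [|k IH].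
  by rewrite /scaled_deriv !expr0 !mul1r derivn0.
apply: le_trans (scaled_deriv_step_le _ _ _ qz) _.
by rewrite exprS -(mulrA (2 * _)) ler_wpM2l// mulr_ge0.
Qed.

(** * Root bounds and growth at infinity *)

Lemma exists_roots_in_disc q : q != 0 ->
  exists2 r : C, 0 <= r & roots_in_disc q r.
Proof.
move=> /log_deriv_roots[s [_ rootE _]].
exists (\sum_(y <- s) `|y|); first by apply: sumr_ge0.
move=> y; rewrite rootE => ys.
by rewrite (perm_big _ (perm_to_rem ys))/= big_cons lerDl sumr_ge0.
Qed.

Lemma exists_max_root q : (1 < size q)%N ->
  exists2 y, root q y & roots_in_disc q `|y|.
Proof.
move=> q1; have q0 : q != 0 by rewrite -size_poly_gt0 ltnW.
have [s [sq rootE _]] := log_deriv_roots _ q0.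
suff [y ys ymax] : exists2 y, y \in s & forall x, x \in s -> `|x| <= `|y|.
  by exists y => [|x]; rewrite rootE//; exact: ymax.
have : s != [::] by rewrite -size_eq0 sq -lt0n -subn1 subn_gt0.
elim: s {sq rootE} => [//|x [|x' s] IH] _.
  by exists x; rewrite ?mem_head// => y; rewrite inE => /eqP->.
have [//|y ys ymax] := IH.
(* The order of [C] is partial, but moduli are real and hence comparable. *)
have [xy|yx] := real_leP (normr_real x) (normr_real y).
  by exists y => [|z]; rewrite inE ?ys ?orbT// => /predU1P[->//|/ymax].
exists x => [|z]; rewrite inE ?eqxx// => /predU1P[->//|/ymax/le_trans]; apply.
exact: ltW.
Qed.

Lemma horner_growth_le q k : (size q <= k.+1)%N ->
  exists2 c : C, 0 <= c & forall z, 1 <= `|z| -> `|q.[z]| <= c * `|z| ^+ k.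
Proof.
move=> qk; exists (\sum_(i < k.+1) `|q`_i|); first by apply: sumr_ge0.
move=> z z1; rewrite (horner_coef_wide _ qk) mulr_suml.
apply: le_trans (ler_norm_sum _ _ _) _; apply: ler_sum => i _.
by rewrite normrM ler_wpM2l// normrX ler_weXn2l// -ltnS.
Qed.

Lemma horner_growth_ge q k : size q = k.+1 ->
  exists c r : C, [/\ 0 < c, 1 <= r &
    forall z, r <= `|z| -> c * `|z| ^+ k <= `|q.[z]|].
Proof.
move=> qk.
have l0 : 0 < `|q`_k|.
  by rewrite normr_gt0 -[k]/(k.+1.-1) -qk -lead_coefE lead_coef_eq0 -size_poly_gt0 qk.
(* The factor ['X] gives a bound of order [k - 1] on the lower-order part without writing [k - 1],
   so [k = 0] needs no separate case. *)
have [|c c0 cz] := @horner_growth_le ('X * take_poly k q) k.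
  by rewrite (leq_trans (size_polyMleq _ _))// size_polyX/= ltnS size_take_poly.
(* Beyond this radius the lower-order part is at most half of the leading term. *)
exists (`|q`_k| / 2), (1 + 2 * c / `|q`_k|); split.
- by rewrite divr_gt0.
- by rewrite lerDl divr_ge0// mulr_ge0.
move=> z rz.
have z1 : 1 <= `|z| by apply: le_trans rz; rewrite lerDl divr_ge0// mulr_ge0.
have z0 : 0 < `|z| by apply: lt_le_trans z1.
have qE : q = take_poly k q + q`_k *: 'X^k.
  apply/polyP => i; rewrite coefD coefZ coefXn coef_take_poly.
  case: ltngtP => [ik|ik|->]; rewrite ?mulr0 ?addr0 ?mulr1 ?add0r//.
  by rewrite nth_default// qk.
have tz : `|(take_poly k q).[z]| <= `|q`_k| / 2 * `|z| ^+ k.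
  rewrite -(ler_pM2l z0) -normrM.
  have := cz z z1; rewrite !hornerE => /le_trans; apply.
  rewrite ler_wpM2r ?exprn_ge0// ler_pdivlMr// -ler_pdivrMr//.
  by apply: le_trans rz; rewrite [c * 2]mulrC lerDr.
have -> : q.[z] = q`_k * z ^+ k + (take_poly k q).[z].
  by rewrite {1}qE hornerD hornerZ hornerXn addrC.
apply: le_trans (lerB_normD _ _).
by rewrite normrM normrX lerBrDr [X in _ <= X * _]splitr mulrDl lerD2l.
Qed.

Lemma coefM_top (A B : {poly C}) i j : (size A <= i.+1)%N -> (size B <= j.+1)%N ->
  (A * B)`_(i + j) = A`_i * B`_j.
Proof.
move=> Ai Bj; rewrite coefM.
have iij : (i < (i + j).+1)%N by rewrite ltnS leq_addr.
rewrite (bigD1 (Ordinal iij))//= addKn big1 ?addr0// => l.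
rewrite -val_eqE/= neq_ltn => /orP[li|il].
  by rewrite [B`__]nth_default ?mulr0// (leq_trans Bj)// ltn_subRL ltn_add2r.
by rewrite nth_default ?mul0r// (leq_trans Ai).
Qed.

(** * The eigenvalue equation and both implications *)

Section Operator.

Variables (N : nat) (a : nat -> {poly C}) (p : nat -> {poly C}).
Hypothesis eigen_p : eigenpolynomial_system (diffop N a) p.

(** In the equation for [p k] the terms of order above [k] vanish and the [k]-th derivative is a
    nonzero constant. Thus [a k] is a combination of [p k] and of terms of lower order, whose
    degrees are at most [k] by strong induction. *)
Lemma size_coef_eigen k : (0 < k <= N)%N -> (size (a k) <= k.+1)%N.
Proof.
have [sp ep] := eigen_p.
elim/ltn_ind: k => k IH /andP[k0 kN].
have [l] := ep k; rewrite /diffop.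
rewrite (big_cat_nat (n := k.+1))//= [X in _ + X]big_nat [X in _ + X]big1; last first.
  by move=> i /andP[ki _]; rewrite derivn_poly0 ?mulr0// sp.
rewrite addr0 big_nat_recr//=.
have pk : (p k)^`(k) = ((p k)`_k *+ k`!)%:P.
  apply/polyP => -[|i]; rewrite coef_derivn coefC/= ?addn0 ?ffactnn//.
  by rewrite nth_default ?mul0rn// sp addnS ltnS leq_addr.
have u0 : (p k)`_k *+ k`! != 0.
  rewrite mulrn_eq0 negb_or -lt0n fact_gt0/=.
  by rewrite -[k in _`_k]/(k.+1.-1) -(sp k) -lead_coefE lead_coef_eq0 -size_poly_gt0 sp.
rewrite pk [a k * _]mulrC mul_polyC => /eqP; rewrite eq_sym addrC -subr_eq => /eqP e.
rewrite -(size_scale _ u0) -e; apply: (leq_trans (size_polyD _ _)).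
rewrite geq_max size_polyN (leq_trans (size_scale_leq _ _)) ?sp//=.
rewrite big_nat; apply: (big_ind (fun q : {poly C} => size q <= k.+1)%N).
- by rewrite size_poly0.
- by move=> A B Ak Bk; rewrite (leq_trans (size_polyD _ _))// geq_max Ak.
move=> i /andP[i0 ik]; apply: (leq_trans (size_polyMleq _ _)).
have := IH i ik; rewrite i0 (ltnW (leq_trans ik kN)) => /(_ isT) ai.
by rewrite size_derivn_num sp; lia.
Qed.

(** Comparison of the coefficients of degree [n], the top degree possible on both sides by
    [size_coef_eigen]. *)
Lemma eigenvalue_coef n l : diffop N a (p n) = l *: p n ->
  l = \sum_(1 <= k < N.+1) (a k)`_k *+ n ^_ k.
Proof.
have [sp ep] := eigen_p.
have u0 : (p n)`_n != 0.
  by rewrite -[n in _`_n]/(n.+1.-1) -(sp n) -lead_coefE lead_coef_eq0 -size_poly_gt0 sp.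
move=> /(congr1 (fun q : {poly C} => q`_n)); rewrite coefZ coef_sum => e.
apply: (mulIf u0); rewrite -e mulr_suml !big_nat; apply: eq_bigr => k kN.
have [nk|kn] := ltnP n k.
  by rewrite derivn_poly0 ?sp// ffact_small// mulr0 coef0 mul0r.
rewrite -{2}(subnKC kn) coefM_top ?size_coef_eigen//.
  by rewrite coef_derivn subnKC// mulrnAr mulrnAl.
by rewrite size_derivn_num sp subSn.
Qed.

Lemma eigen_horner n l z : diffop N a (p n) = l *: p n ->
  \sum_(1 <= k < N.+1) (a k).[z] * (p n)^`(k).[z] = l * (p n).[z].
Proof.
move=> /(congr1 (fun q => q.[z])); rewrite hornerZ => <-.
by rewrite horner_sum; apply: eq_bigr => k _; rewrite hornerM.
Qed.

Hypothesis N_gt0 : (0 < N)%N.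
(** The Archimedean property, which lets [n] exceed constants of the abstract field [C]. *)
Hypothesis nat_unbounded : forall x : C, exists n : nat, `|x| < n%:R.

Lemma size_coef_of_bounded_roots (M : C) : 0 <= M -> a N != 0 ->
  (forall n, roots_in_disc (p n) M) -> size (a N) = N.+1.
Proof.
move=> M0 aN0 pM; apply/eqP; rewrite eqn_leq size_coef_eigen ?N_gt0 ?leqnn//=.
rewrite ltnNge; apply/negP => aN.
have [sp ep] := eigen_p.
have [B B0 aB] := exists_roots_in_disc _ aN0.
(* Large enough that [a N] does not vanish at [z] and that all roots of every [p n] lie within
   [|z| / 2]. *)
pose z : C := 2 * M + B + 1.
have z_gt0 : 0 < z by rewrite ltr_wpDl// addr_ge0// mulr_ge0.
have z0 : z != 0 by rewrite gt_eqF.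
have nz : `|z| = z by rewrite ger0_norm ?ltW.
have aNz : (a N).[z] != 0.
  apply/negP => /aB; rewrite nz; apply/negP; rewrite lt_geF//.
  by rewrite /z -addrA ltr_wpDl ?mulr_ge0// ltrDl.
have pz n : roots_in_disc (p n) (`|z| / 2).
  move=> y /pM/le_trans; apply; rewrite nz ler_pdivlMr// mulrC /z -addrA lerDl.
  by rewrite addr_ge0.
have pz' n : roots_in_disc (p n) `|z|.
  by move=> y /pz/le_trans; apply; rewrite nz ler_pdivrMr// mulr_natr mulr2n lerDl ltW.
pose c k := (a k).[z] / z ^+ k.
(* The first summand comes from the eigenvalue, the second from the terms of order [k < N], with
   [2 ^+ k] from [scaled_deriv_le]. *)
pose S := \sum_(1 <= k < N) (`|(a k)`_k| + `|c k| * 2 ^+ k).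
have S0 : 0 <= S by apply: sumr_ge0 => k _; rewrite addr_ge0// mulr_ge0// exprn_ge0.
have cN0 : 0 < `|c N| by rewrite normr_gt0 mulf_neq0// invr_eq0 expf_neq0.
have [m mP] := nat_unbounded (4 ^+ N * S / `|c N|).
(* The summand [2 * N] makes [scaled_deriv_ge] available up to order [N]. *)
pose n := (m + 2 * N)%N.
have [l el] := ep n.
have n_gt0 : (0 < n)%N by rewrite /n; lia.
have pnz : 0 < `|(p n).[z]|.
  rewrite normr_gt0; apply/negP => /pz; apply/negP; rewrite lt_geF//.
  by rewrite ltr_pdivrMr ?nz// mulr_natr mulr2n ltrDl.
have D_le k : `|scaled_deriv (p n) z k| <= (2 * n%:R) ^+ k * `|(p n).[z]|.
  by have := scaled_deriv_le (p n) z k (pz n); rewrite sp.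
have D_ge : (n%:R / 4) ^+ N * `|(p n).[z]| <= `|scaled_deriv (p n) z N|.
  have := scaled_deriv_ge (p n) z 0 N (pz' n); rewrite sp/= add0n => /(_ _).
  by rewrite /scaled_deriv expr0 mul1r derivn0; apply; rewrite /n leq_addl.
have l_le : `|l| <= \sum_(1 <= k < N) `|(a k)`_k| * n%:R ^+ N.-1.
  (* As the degree of [a N] is assumed below [N], the only contribution of order [n ^ N] drops
     out. *)
  rewrite (eigenvalue_coef _ _ el) big_nat_recr//= [X in _ + X *+ _]nth_default//.
  rewrite mul0rn addr0 (le_trans (ler_norm_sum _ _ _))//.
  rewrite !big_nat; apply: ler_sum => k /andP[k1 kN].
  rewrite normrMn -[_ *+ n ^_ k]mulr_natr ler_wpM2l// -natrX ler_nat.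
  by rewrite (leq_trans (ffact_le_exp _ _))// leq_pexp2l// -ltnS prednK.
have := eigen_horner _ _ z el.
under eq_bigr => k _.
  have -> : (a k).[z] * (p n)^`(k).[z] = c k * scaled_deriv (p n) z k.
    by rewrite /c /scaled_deriv mulrA divfK ?expf_neq0.
  over.
rewrite big_nat_recr//= => e.
have {e} : `|c N| * `|scaled_deriv (p n) z N| <= S * n%:R ^+ N.-1 * `|(p n).[z]|.
  rewrite -normrM (_ : _ * _ = l * (p n).[z] -
     \sum_(1 <= k < N) c k * scaled_deriv (p n) z k); last first.
    by rewrite -e addrAC subrr add0r.
  rewrite (le_trans (ler_normB _ _))//.
  rewrite /S big_split/= 2!mulrDl normrM lerD//.
    by rewrite ler_wpM2r// mulr_suml.
  rewrite (le_trans (ler_norm_sum _ _ _))// !mulr_suml !big_nat.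
  apply: ler_sum => k /andP[k1 kN]; rewrite normrM -!mulrA ler_wpM2l//.
  rewrite (le_trans (D_le k))// exprMn -mulrA ler_wpM2l ?exprn_ge0//.
  rewrite ler_wpM2r// -!natrX ler_nat leq_pexp2l// -ltnS prednK//.
(* After cancelling [|p n (z)|] and [n ^ (N - 1)] there remains [|c N| * n <= 4 ^ N * S], against
   the choice of [m]. *)
move=> /(le_trans (ler_wpM2l (ltW cN0) D_ge)).
rewrite mulrA ler_pM2r// expr_div_n mulrA ler_pdivrMr ?exprn_gt0//.
rewrite -[in n%:R ^+ N](prednK N_gt0) exprS mulrA.
rewrite [leRHS]mulrAC ler_pM2r ?exprn_gt0 ?ltr0n//.
apply/negP; rewrite lt_geF// [S * _]mulrC [`|c N| * _]mulrC -ltr_pdivrMr//.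
have X0 : 0 <= 4 ^+ N * S / `|c N| by rewrite divr_ge0// mulr_ge0// exprn_ge0.
rewrite (ger0_norm X0) in mP; apply: lt_le_trans mP _.
by rewrite ler_nat leq_addr.
Qed.

Lemma bounded_roots_of_size_coef : size (a N) = N.+1 ->
  exists2 M : C, 0 <= M & forall n, roots_in_disc (p n) M.
Proof.
move=> /horner_growth_ge[c [r [c0 r1 cr]]].
have [sp ep] := eigen_p.
have [C_ C_ge0 C_le] : exists2 C_ : nat -> C, forall k, 0 <= C_ k &
    forall k z, (0 < k <= N)%N -> 1 <= `|z| -> `|(a k).[z]| <= C_ k * `|z| ^+ k.
  have /choice : forall k, exists b : C, 0 <= b /\
    forall z, (0 < k <= N)%N -> 1 <= `|z| -> `|(a k).[z]| <= b * `|z| ^+ k.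
    move=> k; have [/size_coef_eigen/horner_growth_le[b b0 bz]|/negbTE kN] :=
      boolP (0 < k <= N)%N; last by exists 0; split=> // z; rewrite kN.
    by exists b; split=> // z _; exact: bz.
  move=> [b bP]; exists b => [k|k z]; first by have [] := bP k.
  by have [_] := bP k; apply.
pose S := \sum_(1 <= k < N) C_ k.
have S0 : 0 <= S by apply: sumr_ge0.
have [m mP] := nat_unbounded (S * 8 / c).
(* [m] yields [S * (4 / n) <= c / 2], [2 * N] serves [scaled_deriv_ge], and 4 gives [n / 4 >= 1]. *)
pose n0 := (m + 2 * N + 4)%N.
have r_ge0 : 0 <= r by apply: le_trans r1.
have key n l z : (n0 <= n)%N -> diffop N a (p n) = l *: p n ->
    r <= `|z| -> roots_in_disc (p n) `|z| ->
    `|scaled_deriv (p n) z 1| <= 2 * `|l| / c * `|(p n).[z]|.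
  move=> n0n el rz pz.
  have z1 : 1 <= `|z| by apply: le_trans rz.
  have n4 : 1 <= n%:R / 4 :> C by rewrite ler_pdivlMr// mul1r ler_nat; lia.
  have n_gt0 : (0 < n)%N by lia.
  have D_ge k : (k <= N)%N ->
     (n%:R / 4) ^+ (N - k) * `|scaled_deriv (p n) z k| <= `|scaled_deriv (p n) z N|.
    move=> kN; have := scaled_deriv_ge (p n) z k (N - k) pz.
    by rewrite sp/= subnKC//; apply; lia.
  have D_lt k : (k < N)%N -> `|scaled_deriv (p n) z k| <=
      4 / n%:R * `|scaled_deriv (p n) z N|.
    move=> kN; rewrite -[4 / _]invf_div ler_pdivlMl ?divr_gt0 ?ltr0n//.
    apply: le_trans (D_ge k (ltnW kN)); rewrite ler_wpM2r//.
    by rewrite ler_eXnr// subn_gt0.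
  have D1_le : `|scaled_deriv (p n) z 1| <= `|scaled_deriv (p n) z N|.
    apply: le_trans (D_ge 1%N N_gt0); rewrite ler_peMl//.
    by rewrite exprn_ege1.
  apply: le_trans D1_le _.
  rewrite mulrAC ler_pdivlMr//.
  have := eigen_horner _ _ z el; rewrite big_nat_recr//= => e.
  have norm_scaled k : `|scaled_deriv (p n) z k| = `|z| ^+ k * `|(p n)^`(k).[z]|.
    by rewrite normrM normrX.
  (* Isolate the term of order [N]; each lower one costs a factor [4 / n], so together they are
     absorbed into half of the left side. *)
  have main : c * `|scaled_deriv (p n) z N| <=
      `|l| * `|(p n).[z]| + S * (4 / n%:R) * `|scaled_deriv (p n) z N|.
    apply: (@le_trans _ _ `|(a N).[z] * (p n)^`(N).[z]|).
      by rewrite norm_scaled mulrA normrM ler_wpM2r// cr.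
    rewrite (_ : _ * _ = l * (p n).[z] -
      \sum_(1 <= k < N) (a k).[z] * (p n)^`(k).[z]); last first.
      by rewrite -e addrAC subrr add0r.
    rewrite (le_trans (ler_normB _ _))// normrM lerD2l.
    rewrite (le_trans (ler_norm_sum _ _ _))// !mulr_suml !big_nat.
    apply: ler_sum => k /andP[k1 kN]; rewrite normrM.
    apply: (@le_trans _ _ (C_ k * `|scaled_deriv (p n) z k|)).
      by rewrite norm_scaled mulrA ler_wpM2r// C_le// k1 ltnW.
    by rewrite -(mulrA (C_ k)) ler_wpM2l// D_lt.
  have Sc : S * (4 / n%:R) <= c / 2.
    rewrite mulrA ler_pdivrMr ?ltr0n// mulrAC ler_pdivlMr//.
    rewrite -mulrA -natrM [c * _]mulrC -ler_pdivrMr//.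
    have X0 : 0 <= S * 8 / c by rewrite divr_ge0// ?mulr_ge0// ltW.
    rewrite (ger0_norm X0) in mP; apply: le_trans (ltW mP) _.
    by rewrite ler_nat; lia.
  have := le_trans main (lerD (lexx _) (ler_wpM2r (normr_ge0 _) Sc)).
  rewrite -lerBlDr -mulrBl {1}[c]splitr addrK.
  by rewrite mulrAC ler_pdivrMr// [c * _]mulrC -(mulrA 2) [2 * _]mulrC.
have big n : (n0 <= n)%N -> roots_in_disc (p n) r.
  move=> n0n y0 py0.
  have n1 : (1 < size (p n))%N by rewrite sp; lia.
  have [y py ymax] := exists_max_root _ n1.
  apply: le_trans (ymax _ py0) _.
  rewrite real_leNgt ?normr_real ?ger0_real//; apply/negP => ry.
  have [l el] := ep n.
  have y_gt0 : 0 < `|y| by apply: le_lt_trans ry.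
  have y_neq0 : y != 0 by rewrite -normr_gt0.
  (* With eps = 1 / (T + 1), z / (z - y) = T + 2. *)
  pose T := 2 * `|l| / c.
  have T0 : 0 <= T by rewrite divr_ge0 ?mulr_ge0// ltW.
  have T1 : 0 < T + 1 by rewrite ltr_wpDl.
  pose z := (1 + (T + 1)^-1) * y.
  have yz : `|y| < `|z|.
    rewrite /z normrM ger0_norm ?addr_ge0 ?invr_ge0 ?(ltW T1)//.
    by rewrite mulrDl mul1r ltrDl mulr_gt0// invr_gt0.
  have pz : roots_in_disc (p n) `|z| by move=> x /ymax/le_trans; apply; exact: ltW.
  have pz0 : ~~ root (p n) z by apply/negP => /ymax; rewrite lt_geF.
  have := key _ _ _ n0n el (ltW (lt_trans ry yz)) pz.
  rewrite /scaled_deriv expr1 derivn1 -/T -ler_pdivrMr ?normr_gt0// -normf_div.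
  apply/negP; rewrite lt_geF//.
  have := log_deriv_ge_root _ _ _ pz pz0 py.
  have -> : z / (z - y) = T + 1 + 1.
    rewrite /z; field; rewrite (gt_eqF T1)/=.
    by rewrite (_ : _ + _ = y)//; ring.
  rewrite (Creal_ReP (T + 1 + 1) _) ?ger0_real ?(addr_ge0 (ltW T1))// => h.
  apply: (@lt_le_trans _ _ (T + 1 + 1)); first by rewrite -addrA ltrDl addr_gt0.
  by apply: le_trans h _; rewrite leif_Re_Creal.
(* The finitely many remaining polynomials; radii are added in place of taking a maximum. *)
have [B B0 small] : exists2 B : C, 0 <= B &
    forall n, (n < n0)%N -> roots_in_disc (p n) B.
  elim: n0 {big key} => [|k [B B0 IH]]; first by exists 0.
  have pk : p k != 0 by rewrite -size_poly_gt0 sp.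
  have [B' B'0 kB'] := exists_roots_in_disc _ pk.
  exists (B + B') => [|n]; first exact: addr_ge0.
  rewrite ltnS leq_eqVlt => /predU1P[->|nk] y py.
    by rewrite (le_trans (kB' _ py))// lerDr.
  by rewrite (le_trans (IH _ nk _ py))// lerDl.
exists (r + B) => [|n y py]; first exact: addr_ge0.
have [n0n|nn0] := leqP n0 n.
  by rewrite (le_trans (big _ n0n _ py))// lerDl.
by rewrite (le_trans (small _ nn0 _ py))// lerDr.
Qed.
End Operator.
End EigenpolynomialRoots.

(** * Topology of [R[i]] and the real line *)

Section RealComplex.
Variable R : realType.

Lemma complex_nat_unbounded (x : R[i]) : exists n : nat, `|x| < n%:R.
Proof.
exists (Num.bound (complex.Re `|x|)).
have xR : `|x| \is Num.real := normr_real x.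
rewrite -(RRe_real xR) -(rmorph_nat (real_complex R)) ltcR.
by apply: archi_boundP; rewrite -ler0c (RRe_real xR).
Qed.

Lemma continuous_Re : continuous (@complex.Re R : R[i]^o -> R).
Proof.
move=> x; apply/(@cvgrPdist_lt _ _ _ _ (nbhs_filter (x : R[i]^o))) => e e0.
apply/(@nbhs_normP _ (R[i]^o) x); exists e%:C%C => /=; first by rewrite ltcR.
move=> y /= xy; rewrite -ltcR -raddfB.
exact: le_lt_trans (normc_ge_Re _) xy.
Qed.

Lemma continuous_real_complex : continuous (real_complex R : R -> R[i]^o).
Proof.
move=> x; apply/cvgrPdist_lt => e e0.
have eE : e = (complex.Re e)%:C%C by rewrite RRe_real// gtr0_real.
apply/nbhs_normP; exists (complex.Re e) => /=; first by rewrite -ltcR -eE.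
move=> y /= xy.
by rewrite -rmorphB/= normc_def/= expr0n addr0 sqrtr_sqr eE ltcR.
Qed.

End RealComplex.

Theorem proposition1 (R : realType) (N : nat) (a : nat -> {poly R[i]})
    (p : nat -> {poly R[i]})
    (order_N : has_order N a)
    (eigen_p : eigenpolynomial_system (diffop N a) p)
    (real_zeros : forall (n : nat) (z : R[i]), root (p n) z -> z \is Num.real) :
  (exists K : set R[i]^o,
      compact K /\ forall (n : nat) (z : R[i]), root (p n) z -> K z)
  <-> size (a N) = N.+1.
Proof.
have [N_gt0 aN0] := order_N.
split=> [[K [Kcompact pK]]|aN].
  (* The zeros are real, so a bound on the real parts over [K] bounds their moduli. *)
  have : compact (@complex.Re R @` K).
    by apply: continuous_compact => //; apply/continuous_subspaceT/continuous_Re.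
  move=> /compact_bounded/ex_strict_bound_gt0[M M0 KM].
  apply: (@size_coef_of_bounded_roots _ _ _ _ eigen_p N_gt0
    (@complex_nat_unbounded R) M%:C%C) => //; first by rewrite ler0c ltW.
  move=> n z pz.
  rewrite -(RRe_real (real_zeros _ _ pz)) normc_def/= expr0n addr0 sqrtr_sqr lecR.
  by apply/ltW/KM; exists z => //; exact: pK pz.
have [M M0 pM] := bounded_roots_of_size_coef _ _ _ _ eigen_p N_gt0
  (@complex_nat_unbounded R) aN.
(* [M] is nonnegative, hence equal to its real part; real zeros in the disc of radius [M] lie on
   this segment. *)
exists (real_complex R @` `[- complex.Re M, complex.Re M]); split.
  apply: continuous_compact; last exact: segment_compact.
  exact/continuous_subspaceT/continuous_real_complex.
move=> n z pz; have zR := real_zeros n z pz.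
exists (complex.Re z); last exact: RRe_real.
rewrite /= in_itv/= -ler_norml -lecR (RRe_real (ger0_real M0)).
exact: le_trans (normc_ge_Re _) (pM n z pz).
Qed.
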